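(* Let $V$ be a vector space over $k$ with braiding $R:V\otimes V\to V\otimes V$. Let $\mathcal{H}_R$ be the category whose objects are bialgebras $H$ together with an action of $H$ on $V$ such that the action of $H$ on $V\otimes V$ induced by the comultiplication of $H$ preserves $R$ (i.e. commutes with $R$), and whose morphisms are the bialgebra homomorphisms compatible with the actions on $V$. Then $P_R(V)$, with its action on $V$ given by the universal measuring map, is a final object in $\mathcal{H}_R$.
   Context: $k$ is $\mathbb{R}$ or $\mathbb{C}$; algebras are associative unital, coalgebras coassociative counital. A linear map $\sigma:C\to \mathrm{Hom}_k(A,B)$ from a coalgebra $C$, with $A,B$ algebras, is a measuring map if $\sigma(c)(aa')=\sum_{(c)}\sigma(c_{(1)})(a)\,\sigma(c_{(2)})(a')$ and $\sigma(c)(1_A)=\epsilon(c)1_B$. The universal measuring coalgebra $\pi:P(A,B)\to \mathrm{Hom}(A,B)$ is the measuring coalgebra such that every measuring map $\sigma:C\to\mathrm{Hom}(A,B)$ factors as $\sigma=\pi\circ\rho$ for a unique coalgebra map $\rho:C\to P(A,B)$. $P(A,A)$ is a bialgebra with multiplication induced by composition in $\mathrm{End}(A)$. A braiding on $V$ is an invertible linear map $R:V\otimes V\to V\otimes V$ satisfying $(\mathrm{id}\otimes R)(R\otimes\mathrm{id})(\mathrm{id}\otimes R)=(R\otimes\mathrm{id})(\mathrm{id}\otimes R)(R\otimes\mathrm{id})$. Let $TV$ be the tensor algebra. A measuring map $\sigma:C\to\mathrm{End}(TV)$ preserves $(V,R)$ if $\sigma(c)(V)\subset V$ and $R(\sigma\otimes\sigma)(\Delta(c))(v\otimes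 w)=(\sigma\otimes\sigma)(\Delta(c))R(v\otimes w)$ for all $c\in C$, $v,w\in V$. The $R$-transformation algebra $P_R(V)$ is the largest sub-bialgebra of $P(TV,TV)$ which preserves $(V,R)$ (under the restriction of $\pi$); it acts on $V$ by $p\cdot v=\pi(p)(v)$. *)

(* Defs.v *)
From HB Require Import structures.
From mathcomp Require Import all_boot all_order all_algebra.
From mathcomp Require Import generic_quotient.
From mathcomp Require Import boolp classical_sets reals.
From mathcomp Require Import complex.

Set Implicit Arguments.
Unset Strict Implicit.
Unset Printing Implicit Defensive.

Import GRing.Theory.
Local Open Scope ring_scope.
Local Open Scope quotient_scope.

Definition real_or_complex (F : realType) (k : fieldType) : Prop :=
  k = F :> fieldType \/ k = complex F :> fieldType.

Definition bilin (k : fieldType) (U V W : lmodType k) (f : U -> V -> W) : Prop :=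
  (forall v, linear (f^~ v)) /\ (forall u, linear (f u)).

(* The tensor product U ⊗ V: formal sums of triples (a, u, v), standing for    *)
(* a *: (u ⊗ v), modulo the relations that hold under every bilinear map       *)
(* (impredicatively, the least relations making u ⊗ v bilinear). The lemmas    *)
(* tens_bilin, tlift_tens, tlift_linear and tlift_unique below are the usual   *)
(* universal property.                                                         *)
Section Tensor.
Variables (k : fieldType) (U V : lmodType k).

Definition tsum_eval (W : lmodType k) (f : U -> V -> W) (s : seq (k * U * V)) : W :=
  \sum_(x <- s) x.1.1 *: f x.1.2 x.2.

Definition tsum_eqv (s t : seq (k * U * V)) : bool :=
  `[< forall (W : lmodType k) (f : U -> V -> W), bilin f ->
        tsum_eval f s = tsum_eval f t >].

Lemma tsum_eqv_refl : reflexive tsum_eqv.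
Proof. by move=> s; apply/asboolP. Qed.

Lemma tsum_eqv_sym : symmetric tsum_eqv.
Proof.
by move=> s t; apply/asboolP/asboolP => h W f bf; rewrite h.
Qed.

Lemma tsum_eqv_trans : transitive tsum_eqv.
Proof.
move=> t s r /asboolP h1 /asboolP h2; apply/asboolP => W f bf.
by rewrite h1 // h2.
Qed.

Canonical tsum_equiv :=
  EquivRel tsum_eqv tsum_eqv_refl tsum_eqv_sym tsum_eqv_trans.

Definition tensor := {eq_quot tsum_equiv}.
HB.instance Definition _ := Choice.on tensor.
HB.instance Definition _ := EqQuotient.on tensor.

Definition tens (u : U) (v : V) : tensor := \pi_tensor [:: (1, u, v)].

(* The linear map U ⊗ V -> W induced by f; meaningful only for bilinear f. *)
Definition tlift (W : lmodType k) (f : U -> V -> W) (t : tensor) : W :=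
  tsum_eval f (repr t).

Lemma tsum_eval_nil (W : lmodType k) (f : U -> V -> W) : tsum_eval f [::] = 0.
Proof. by rewrite /tsum_eval big_nil. Qed.

Lemma tsum_eval_cat (W : lmodType k) (f : U -> V -> W) s t :
  tsum_eval f (s ++ t) = tsum_eval f s + tsum_eval f t.
Proof. by rewrite /tsum_eval big_cat. Qed.

Definition tsum_scale (a : k) (s : seq (k * U * V)) :=
  [seq (a * x.1.1, x.1.2, x.2) | x <- s].

Lemma tsum_eval_scale (W : lmodType k) (f : U -> V -> W) a s :
  tsum_eval f (tsum_scale a s) = a *: tsum_eval f s.
Proof.
rewrite /tsum_eval big_map scaler_sumr.
by apply: eq_bigr => x _ /=; rewrite scalerA.
Qed.

Lemma tlift_pi (W : lmodType k) (f : U -> V -> W) s :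
  bilin f -> tlift f (\pi_tensor s) = tsum_eval f s.
Proof.
move=> bf; rewrite /tlift.
have /eqmodP/asboolP : repr (\pi_tensor s) = s %[mod tensor] by rewrite reprK.
exact.
Qed.

Lemma tensorP (s t : tensor) :
  (forall (W : lmodType k) (f : U -> V -> W), bilin f -> tlift f s = tlift f t) ->
  s = t.
Proof.
move=> h; rewrite -[s]reprK -[t]reprK; apply/eqmodP/asboolP => W f bf.
exact: h.
Qed.

Definition tensor_zero : tensor := \pi_tensor [::].
Definition tensor_add (s t : tensor) : tensor := \pi_tensor (repr s ++ repr t).
Definition tensor_scale (a : k) (t : tensor) : tensor :=
  \pi_tensor (tsum_scale a (repr t)).
Definition tensor_opp (t : tensor) : tensor := tensor_scale (-1) t.

Let tlift0 (W : lmodType k) (f : U -> V -> W) (bf : bilin f) :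
  tlift f tensor_zero = 0.
Proof. by rewrite tlift_pi // tsum_eval_nil. Qed.

Let tliftD (W : lmodType k) (f : U -> V -> W) (bf : bilin f) s t :
  tlift f (tensor_add s t) = tlift f s + tlift f t.
Proof. by rewrite tlift_pi // tsum_eval_cat. Qed.

Let tliftZ (W : lmodType k) (f : U -> V -> W) (bf : bilin f) a t :
  tlift f (tensor_scale a t) = a *: tlift f t.
Proof. by rewrite tlift_pi // tsum_eval_scale. Qed.

Let tliftN (W : lmodType k) (f : U -> V -> W) (bf : bilin f) t :
  tlift f (tensor_opp t) = - tlift f t.
Proof. by rewrite tliftZ // scaleN1r. Qed.

Fact tensor_addA : associative tensor_add.
Proof. by move=> x y z; apply: tensorP => W f bf; rewrite !tliftD // addrA. Qed.

Fact tensor_addC : commutative tensor_add.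
Proof. by move=> x y; apply: tensorP => W f bf; rewrite !tliftD // addrC. Qed.

Fact tensor_add0 : left_id tensor_zero tensor_add.
Proof. by move=> x; apply: tensorP => W f bf; rewrite tliftD // tlift0 // add0r. Qed.

Fact tensor_addN : left_inverse tensor_zero tensor_opp tensor_add.
Proof.
by move=> x; apply: tensorP => W f bf; rewrite tliftD // tliftN // tlift0 // addNr.
Qed.

HB.instance Definition _ :=
  GRing.isZmodule.Build tensor tensor_addA tensor_addC tensor_add0 tensor_addN.

Fact tensor_scaleA a b x : tensor_scale a (tensor_scale b x) = tensor_scale (a * b) x.
Proof. by apply: tensorP => W f bf; rewrite !tliftZ // scalerA. Qed.

Fact tensor_scale1 : left_id 1 tensor_scale.
Proof. by move=> x; apply: tensorP => W f bf; rewrite !tliftZ // scale1r. Qed.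

Fact tensor_scaleDr : right_distributive tensor_scale +%R.
Proof.
by move=> a x y; apply: tensorP => W f bf; rewrite !(tliftZ, tliftD) // scalerDr.
Qed.

Fact tensor_scaleDl x : {morph tensor_scale^~ x : a b / a + b}.
Proof.
by move=> a b; apply: tensorP => W f bf; rewrite !(tliftZ, tliftD) // scalerDl.
Qed.

HB.instance Definition _ := GRing.Zmodule_isLmodule.Build k tensor
  tensor_scaleA tensor_scale1 tensor_scaleDr tensor_scaleDl.

Lemma tlift_linear (W : lmodType k) (f : U -> V -> W) : bilin f -> linear (tlift f).
Proof. by move=> bf a s t; rewrite tliftD // tliftZ. Qed.

Lemma tlift_tens (W : lmodType k) (f : U -> V -> W) u v :
  bilin f -> tlift f (tens u v) = f u v.
Proof. by move=> bf; rewrite tlift_pi // /tsum_eval big_seq1 scale1r. Qed.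

Lemma tens_bilin : bilin tens.
Proof.
split=> [v|u] a x y; apply: tensorP => W f bf.
  by rewrite tlift_linear // !tlift_tens // bf.1.
by rewrite tlift_linear // !tlift_tens // bf.2.
Qed.

Lemma tensor_sum (t : tensor) :
  t = \sum_(x <- repr t) x.1.1 *: tens x.1.2 x.2.
Proof.
apply: tensorP => W f bf; rewrite {1}/tlift /tsum_eval.
pose g : {linear tensor -> W} :=
  HB.pack (tlift f) (GRing.isLinear.Build _ _ _ _ _ (tlift_linear bf)).
rewrite -[RHS]/(g _) linear_sum; apply: eq_bigr => x _.
by rewrite linearZ /= tlift_tens.
Qed.

Lemma tlift_unique (W : lmodType k) (f : U -> V -> W) (g : {linear tensor -> W}) :
  (forall u v, g (tens u v) = f u v) -> g =1 tlift f.
Proof.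
move=> gf t; rewrite {1}[t]tensor_sum linear_sum.
by apply: eq_bigr => x _; rewrite linearZ /= gf.
Qed.

End Tensor.

Arguments tensor {k} (U V)%_type_scope.
Notation "U ⊗ V" := (tensor U V) (at level 40, left associativity) : type_scope.
Notation "u ⊗ v" := (tens u v) (at level 40, left associativity) : ring_scope.

Section TensorMaps.
Variable k : fieldType.

Definition tmap (U V U' V' : lmodType k) (f : U -> U') (g : V -> V')
  (t : U ⊗ V) : U' ⊗ V' := tlift (fun u v => f u ⊗ g v) t.

Definition tassoc (U V W : lmodType k) (t : (U ⊗ V) ⊗ W) : U ⊗ (V ⊗ W) :=
  tlift (fun s w => tlift (fun u v => u ⊗ (v ⊗ w)) s) t.

Definition tassocV (U V W : lmodType k) (t : U ⊗ (V ⊗ W)) : (U ⊗ V) ⊗ W :=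
  tlift (fun u s => tlift (fun v w => (u ⊗ v) ⊗ w) s) t.

(* The product (a ⊗ b)(c ⊗ d) = ac ⊗ bd of the algebra A ⊗ B. *)
Definition tmul (A B : algType k) (s t : A ⊗ B) : A ⊗ B :=
  tlift (fun a b => tlift (fun c d => (a * c) ⊗ (b * d)) t) s.

Lemma tlift_bilin (U V U' V' W : lmodType k) (f : U -> V -> U' -> V' -> W) :
  (forall u v, bilin (f u v)) -> (forall u' v', bilin (fun u v => f u v u' v')) ->
  forall t', bilin (fun u v => tlift (f u v) t').
Proof.
move=> b1 b2 t'.
by split=> [v|u] a x y; rewrite /tlift /tsum_eval scaler_sumr -big_split /=;
  apply: eq_bigr => z _; have [l1 l2] := b2 z.1.2 z.2;
  rewrite ?l1 ?l2 scalerDr !scalerA mulrC.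
Qed.

Lemma tmap_bilin (U V U' V' : lmodType k) (f : U -> U') (g : V -> V') :
  linear f -> linear g -> bilin (fun u v => f u ⊗ g v).
Proof.
have [b1 b2] := tens_bilin U' V'.
by move=> lf lg; split=> [v|u] a x y; rewrite ?lf ?lg ?b1 ?b2.
Qed.

Lemma tmap_tens (U V U' V' : lmodType k) (f : U -> U') (g : V -> V') u v :
  linear f -> linear g -> tmap f g (u ⊗ v) = f u ⊗ g v.
Proof. by move=> lf lg; rewrite /tmap tlift_tens //; apply: tmap_bilin. Qed.

Lemma tassoc_tens (U V W : lmodType k) (u : U) (v : V) (w : W) :
  tassoc ((u ⊗ v) ⊗ w) = u ⊗ (v ⊗ w).
Proof.
have [b1 b2] := tens_bilin U (V ⊗ W)%type; have [c1 c2] := tens_bilin V W.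
have b (w' : W) : bilin (fun (u' : U) (v' : V) => u' ⊗ (v' ⊗ w')).
  by split=> [v'|u'] a x y /=; [rewrite b1 | rewrite c1 b2].
rewrite /tassoc tlift_tens ?tlift_tens //.
split=> [w'|s] a x y; first exact: tlift_linear.
rewrite /tlift /tsum_eval scaler_sumr -big_split /=.
by apply: eq_bigr => z _; rewrite c2 b2 scalerDr !scalerA mulrC.
Qed.

Lemma tassocV_tens (U V W : lmodType k) (u : U) (v : V) (w : W) :
  tassocV (u ⊗ (v ⊗ w)) = (u ⊗ v) ⊗ w.
Proof.
have [b1 b2] := tens_bilin (U ⊗ V)%type W; have [c1 c2] := tens_bilin U V.
have b (u' : U) : bilin (fun (v' : V) (w' : W) => (u' ⊗ v') ⊗ w').
  by split=> [w'|v'] a x y /=; [rewrite c2 b1 | rewrite b2].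
rewrite /tassocV tlift_tens ?tlift_tens //.
split=> [s|u'] a x y; last exact: tlift_linear.
rewrite /tlift /tsum_eval scaler_sumr -big_split /=.
by apply: eq_bigr => z _; rewrite c1 b1 scalerDr !scalerA mulrC.
Qed.

Lemma tmul_tens (A B : algType k) (a c : A) (b d : B) :
  tmul (a ⊗ b) (c ⊗ d) = (a * c) ⊗ (b * d).
Proof.
have [b1 b2] := tens_bilin A B.
have bl a' b' : bilin (fun (c' : A) (d' : B) => (a' * c') ⊗ (b' * d')).
  by split=> [d'|c'] e x y; rewrite mulrDr -scalerAr ?b1 ?b2.
rewrite /tmul tlift_tens ?tlift_tens //.
apply: tlift_bilin => // c' d'.
by split=> [b'|a'] e x y; rewrite mulrDl -scalerAl ?b1 ?b2.
Qed.

End TensorMaps.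

HB.mixin Record Lmodule_isCoalgebra (k : fieldType) C of GRing.Lmodule k C := {
  comul : {linear C -> (C ⊗ C)%type};
  counit : {scalar C};
  comulA : forall c, tassoc (tmap comul id (comul c)) = tmap id comul (comul c);
  counitl : forall c, tlift (fun x y : C => counit x *: y) (comul c) = c;
  counitr : forall c, tlift (fun x y : C => counit y *: x) (comul c) = c
}.

#[short(type="coalgType")]
HB.structure Definition Coalgebra (k : fieldType) :=
  {C of GRing.Lmodule k C & Lmodule_isCoalgebra k C}.

HB.mixin Record Algebra_Coalgebra_isBialgebra (k : fieldType) H
    of GRing.Algebra k H & Coalgebra k H := {
  comul1 : comul (1 : H) = 1 ⊗ 1;
  comulM : forall g h : H, comul (g * h) = tmul (comul g) (comul h);
  counit1 : counit (1 : H) = 1;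
  counitM : forall g h : H, counit (g * h) = counit g * counit h
}.

#[short(type="bialgType")]
HB.structure Definition Bialgebra (k : fieldType) :=
  {H of GRing.Algebra k H & Coalgebra k H & Algebra_Coalgebra_isBialgebra k H}.

Definition coalgebra_morphism (k : fieldType) (C D : coalgType k) (f : C -> D) : Prop :=
  [/\ linear f,
      forall c, comul (f c) = tmap f f (comul c) &
      forall c, counit (f c) = counit c].

Definition algebra_morphism (k : fieldType) (A B : algType k) (f : A -> B) : Prop :=
  [/\ linear f, f 1 = 1 & {morph f : x y / x * y}].

Definition bialgebra_morphism (k : fieldType) (H K : bialgType k) (f : H -> K) : Prop :=
  algebra_morphism f /\ coalgebra_morphism f.

(* The tensor algebra TV: noncommutative polynomials in the vectors of V, i.e. *)
(* formal sums of pairs (a, [:: v1; ...; vn]) standing for a *: v1 ... vn,     *)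
(* modulo the relations that hold for every linear map from V to an algebra.   *)
(* The lemmas tgen_linear, talg_lift_tgen, talg_lift_morphism and              *)
(* talg_lift_unique are the usual universal property.                          *)
Section TensorAlgebra.
Variables (k : fieldType) (V : lmodType k).

Definition talg_eval (A : algType k) (f : V -> A) (s : seq (k * seq V)) : A :=
  \sum_(x <- s) x.1 *: \prod_(v <- x.2) f v.

Definition talg_eqv (s t : seq (k * seq V)) : bool :=
  `[< forall (A : algType k) (f : V -> A), linear f -> talg_eval f s = talg_eval f t >].

Lemma talg_eqv_refl : reflexive talg_eqv.
Proof. by move=> s; apply/asboolP. Qed.

Lemma talg_eqv_sym : symmetric talg_eqv.
Proof. by move=> s t; apply/asboolP/asboolP => h W f bf; rewrite h. Qed.

Lemma talg_eqv_trans : transitive talg_eqv.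
Proof.
move=> t s r /asboolP h1 /asboolP h2; apply/asboolP => W f bf.
by rewrite h1 // h2.
Qed.

Canonical talg_equiv := EquivRel talg_eqv talg_eqv_refl talg_eqv_sym talg_eqv_trans.

Definition tensor_algebra := {eq_quot talg_equiv}.
HB.instance Definition _ := Choice.on tensor_algebra.
HB.instance Definition _ := EqQuotient.on tensor_algebra.
Local Notation TV := tensor_algebra.

Definition tgen (v : V) : TV := \pi_TV [:: (1, [:: v])].

(* The algebra map TV -> A induced by f; meaningful only for linear f. *)
Definition talg_lift (A : algType k) (f : V -> A) (t : TV) : A := talg_eval f (repr t).

Definition talg_sum_scale (a : k) (s : seq (k * seq V)) := [seq (a * x.1, x.2) | x <- s].

Definition talg_sum_mul (s t : seq (k * seq V)) :=
  [seq (x.1 * y.1, x.2 ++ y.2) | x <- s, y <- t].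

Lemma talg_eval_scale (A : algType k) (f : V -> A) a s :
  talg_eval f (talg_sum_scale a s) = a *: talg_eval f s.
Proof.
rewrite /talg_eval big_map scaler_sumr.
by apply: eq_bigr => x _ /=; rewrite scalerA.
Qed.

Lemma talg_eval_mul (A : algType k) (f : V -> A) s t :
  talg_eval f (talg_sum_mul s t) = talg_eval f s * talg_eval f t.
Proof.
rewrite /talg_eval big_allpairs_dep mulr_suml; apply: eq_bigr => x _ /=.
rewrite mulr_sumr; apply: eq_bigr => y _ /=.
by rewrite big_cat /= -scalerAl -scalerAr scalerA.
Qed.

Lemma talg_lift_pi (A : algType k) (f : V -> A) s :
  linear f -> talg_lift f (\pi_TV s) = talg_eval f s.
Proof.
move=> bf; rewrite /talg_lift.
have /eqmodP/asboolP : repr (\pi_TV s) = s %[mod TV] by rewrite reprK.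
exact.
Qed.

Lemma talgP (s t : TV) :
  (forall (A : algType k) (f : V -> A), linear f -> talg_lift f s = talg_lift f t) ->
  s = t.
Proof.
move=> h; rewrite -[s]reprK -[t]reprK; apply/eqmodP/asboolP => A f lf.
exact: h.
Qed.

Definition talg_zero : TV := \pi_TV [::].
Definition talg_add (s t : TV) : TV := \pi_TV (repr s ++ repr t).
Definition talg_scale (a : k) (t : TV) : TV := \pi_TV (talg_sum_scale a (repr t)).
Definition talg_opp (t : TV) : TV := talg_scale (-1) t.
Definition talg_one : TV := \pi_TV [:: (1, [::])].
Definition talg_mul (s t : TV) : TV := \pi_TV (talg_sum_mul (repr s) (repr t)).

Section Lift.
Variables (A : algType k) (f : V -> A) (lf : linear f).

Let lift0 : talg_lift f talg_zero = 0.
Proof. by rewrite talg_lift_pi // /talg_eval big_nil. Qed.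

Let liftD s t : talg_lift f (talg_add s t) = talg_lift f s + talg_lift f t.
Proof. by rewrite talg_lift_pi // /talg_eval big_cat. Qed.

Let liftZ a t : talg_lift f (talg_scale a t) = a *: talg_lift f t.
Proof. by rewrite talg_lift_pi // talg_eval_scale. Qed.

Let liftN t : talg_lift f (talg_opp t) = - talg_lift f t.
Proof. by rewrite liftZ scaleN1r. Qed.

Let lift1 : talg_lift f talg_one = 1.
Proof. by rewrite talg_lift_pi // /talg_eval big_seq1 big_nil scale1r. Qed.

Let liftM s t : talg_lift f (talg_mul s t) = talg_lift f s * talg_lift f t.
Proof. by rewrite talg_lift_pi // talg_eval_mul. Qed.

Definition talg_liftE := (lift0, liftD, liftN, liftZ, lift1, liftM).

Lemma talg_lift_tgen v : talg_lift f (tgen v) = f v.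
Proof. by rewrite talg_lift_pi // /talg_eval !big_seq1 scale1r. Qed.

End Lift.

Ltac talg_tac :=
  repeat intro; apply: talgP; let A := fresh in let f := fresh in let lf := fresh in
  intros A f lf; rewrite !(talg_liftE lf).

Fact talg_addA : associative talg_add.
Proof. by talg_tac; rewrite addrA. Qed.
Fact talg_addC : commutative talg_add.
Proof. by talg_tac; rewrite addrC. Qed.
Fact talg_add0 : left_id talg_zero talg_add.
Proof. by move=> x; talg_tac; rewrite add0r. Qed.
Fact talg_addN : left_inverse talg_zero talg_opp talg_add.
Proof. by move=> x; talg_tac; rewrite addNr. Qed.

HB.instance Definition _ :=
  GRing.isZmodule.Build TV talg_addA talg_addC talg_add0 talg_addN.

Fact talg_mulA : associative talg_mul.
Proof. by talg_tac; rewrite mulrA. Qed.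
Fact talg_mul1l : left_id talg_one talg_mul.
Proof. by move=> x; talg_tac; rewrite mul1r. Qed.
Fact talg_mul1r : right_id talg_one talg_mul.
Proof. by move=> x; talg_tac; rewrite mulr1. Qed.
Fact talg_mulDl : left_distributive talg_mul talg_add.
Proof. by talg_tac; rewrite mulrDl. Qed.
Fact talg_mulDr : right_distributive talg_mul talg_add.
Proof. by talg_tac; rewrite mulrDr. Qed.
Fact talg_1neq0 : talg_one != talg_zero.
Proof.
apply/eqP => /(congr1 (talg_lift (fun _ => 0 : k^o))).
have l0 : linear (fun _ : V => 0 : k^o) by move=> a x y; rewrite scaler0 addr0.
by rewrite !(talg_liftE l0) => /eqP; rewrite oner_eq0.
Qed.

HB.instance Definition _ := GRing.Zmodule_isNzRing.Build TV
  talg_mulA talg_mul1l talg_mul1r talg_mulDl talg_mulDr talg_1neq0.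

Fact talg_scaleA a b x : talg_scale a (talg_scale b x) = talg_scale (a * b) x.
Proof. by talg_tac; rewrite scalerA. Qed.
Fact talg_scale1 : left_id 1 talg_scale.
Proof. by move=> x; talg_tac; rewrite scale1r. Qed.
Fact talg_scaleDr : right_distributive talg_scale talg_add.
Proof. by move=> x; talg_tac; rewrite scalerDr. Qed.
Fact talg_scaleDl x : {morph talg_scale^~ x : a b / a + b >-> talg_add a b}.
Proof. by talg_tac; rewrite scalerDl. Qed.

HB.instance Definition _ := GRing.Zmodule_isLmodule.Build k TV
  talg_scaleA talg_scale1 talg_scaleDr talg_scaleDl.

Fact talg_scaleAl (a : k) (x y : TV) : a *: (x * y) = (a *: x) * y.
Proof. by apply: (@talgP (talg_scale _ (talg_mul _ _)) (talg_mul (talg_scale _ _) _)) => A f lf; rewrite !(talg_liftE lf) scalerAl. Qed.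

Fact talg_scaleAr (a : k) (x y : TV) : a *: (x * y) = x * (a *: y).
Proof. by apply: (@talgP (talg_scale _ (talg_mul _ _)) (talg_mul _ (talg_scale _ _))) => A f lf; rewrite !(talg_liftE lf) scalerAr. Qed.

HB.instance Definition _ := GRing.Lmodule_isLalgebra.Build k TV talg_scaleAl.
HB.instance Definition _ := GRing.Lalgebra_isAlgebra.Build k TV talg_scaleAr.

Lemma talg_lift_morphism (A : algType k) (f : V -> A) :
  linear f -> algebra_morphism (talg_lift f).
Proof.
move=> lf; split=> [a x y||x y].
- by rewrite -[a *: x]/(talg_scale a x) -[_ + y]/(talg_add _ y) !(talg_liftE lf).
- by rewrite -[1]/talg_one !(talg_liftE lf).
- by rewrite -[x * y]/(talg_mul x y) !(talg_liftE lf).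
Qed.

Lemma tgen_linear : linear tgen.
Proof.
move=> a u v; apply: talgP => A f lf.
by case: (talg_lift_morphism lf) => llf _ _; rewrite llf !talg_lift_tgen // lf.
Qed.

Lemma talg_sum (t : TV) :
  t = \sum_(x <- repr t) x.1 *: \prod_(v <- x.2) tgen v.
Proof.
apply: talgP => A f lf; rewrite {1}/talg_lift /talg_eval.
have [llf l1 lM] := talg_lift_morphism lf.
pose g : {linear TV -> A} := HB.pack (talg_lift f) (GRing.isLinear.Build _ _ _ _ _ llf).
rewrite -[RHS]/(g _) linear_sum; apply: eq_bigr => x _.
rewrite linearZ /= (big_morph _ lM l1); congr (_ *: _).
by apply: eq_bigr => v _; rewrite talg_lift_tgen.
Qed.

Lemma talg_lift_unique (A : algType k) (f : V -> A) (g : TV -> A) :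
  algebra_morphism g -> (forall v, g (tgen v) = f v) -> g =1 talg_lift f.
Proof.
move=> [lg g1 gM] gf t; rewrite {1}[t]talg_sum /talg_lift /talg_eval.
pose h : {linear TV -> A} := HB.pack g (GRing.isLinear.Build _ _ _ _ _ lg).
rewrite -[LHS]/(h _) linear_sum; apply: eq_bigr => x _.
rewrite linearZ /= (big_morph _ gM g1); congr (_ *: _).
by apply: eq_bigr => v _; rewrite gf.
Qed.

End TensorAlgebra.

(* V embeds in TV: it embeds in the square-zero extension k ⊕ V, where vw = 0. *)
Section TgenInjective.
Variables (k : fieldType) (V : lmodType k).

Definition square_zero := (k^o * V)%type.
Local Notation E := square_zero.
HB.instance Definition _ := GRing.Lmodule.on E.

Let one : E := (1, 0).
Let mul (x y : E) : E := (x.1 * y.1, x.1 *: y.2 + y.1 *: x.2).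

Let mulA : associative mul.
Proof.
move=> [a u] [b v] [c w]; rewrite /mul /= mulrA !scalerDr !scalerA addrA.
by rewrite (mulrC c a) (mulrC c b).
Qed.
Let mul1l : left_id one mul.
Proof. by case=> a u; rewrite /mul /= mul1r scale1r scaler0 addr0. Qed.
Let mul1r : right_id one mul.
Proof. by case=> a u; rewrite /mul /= mulr1 scale1r scaler0 add0r. Qed.
Let mulDl : left_distributive mul +%R.
Proof.
move=> [a u] [b v] [c w]; congr pair; rewrite /= ?mulrDl //.
by rewrite scalerDl scalerDr addrACA.
Qed.
Let mulDr : right_distributive mul +%R.
Proof.
move=> [a u] [b v] [c w]; congr pair; rewrite /= ?mulrDr //.
by rewrite scalerDl scalerDr addrACA.
Qed.
Let one_neq0 : one != 0.
Proof. by apply/eqP => -[] /eqP; rewrite oner_eq0. Qed.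
HB.instance Definition _ := GRing.Zmodule_isNzRing.Build E
  mulA mul1l mul1r mulDl mulDr one_neq0.

Let scaleAl (a : k) (x y : E) : a *: (x * y) = (a *: x) * y.
Proof.
case: x y => [b u] [c v]; congr pair; rewrite /= ?scalerAl //.
by rewrite scalerDr !scalerA (mulrC a c).
Qed.
HB.instance Definition _ := GRing.Lmodule_isLalgebra.Build k E scaleAl.
Let scaleAr (a : k) (x y : E) : a *: (x * y) = x * (a *: y).
Proof.
case: x y => [b u] [c v]; congr pair; rewrite /= ?scalerAr //.
by rewrite scalerDr !scalerA (mulrC a b).
Qed.
HB.instance Definition _ := GRing.Lalgebra_isAlgebra.Build k E scaleAr.

Lemma tgen_inj : injective (@tgen k V).
Proof.
pose f (v : V) : E := (0, v).
have lf : linear f.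
  by move=> a u v; congr pair; rewrite /= ?scaler0 ?addr0.
by move=> u v /(congr1 (talg_lift f)); rewrite !talg_lift_tgen // => -[].
Qed.

End TgenInjective.

Section Measuring.
Variable k : fieldType.

(* sigma : C -> Hom(A, B) is given in curried form. *)
Definition measuring (C : coalgType k) (A B : algType k) (sigma : C -> A -> B) : Prop :=
  [/\ bilin sigma,
      forall c a a', sigma c (a * a') =
        tlift (fun c1 c2 => sigma c1 a * sigma c2 a') (comul c) &
      forall c, sigma c 1 = counit c *: 1].

Definition universal_measuring (P : coalgType k) (A B : algType k)
    (pi : P -> A -> B) : Prop :=
  measuring pi /\
  forall (C : coalgType k) (sigma : C -> A -> B), measuring sigma ->
    exists rho : C -> P,
      [/\ coalgebra_morphism rho,
          forall c, sigma c = pi (rho c) &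
          forall rho' : C -> P, coalgebra_morphism rho' ->
            (forall c, sigma c = pi (rho' c)) -> rho' = rho].

(* P(A, A) with the multiplication induced by composition in End(A). *)
Definition universal_measuring_bialgebra (P : bialgType k) (A : algType k)
    (pi : P -> A -> A) : Prop :=
  [/\ universal_measuring pi,
      forall a, pi 1 a = a &
      forall p q a, pi (p * q) a = pi p (pi q a)].

End Measuring.

(* A sub-bialgebra of P, presented by its inclusion map. *)
Definition sub_bialgebra (k : fieldType) (P S : bialgType k) (i : S -> P) : Prop :=
  bialgebra_morphism i /\ injective i.

Section Braiding.
Variables (k : fieldType) (V : lmodType k).
Implicit Type R : V ⊗ V -> V ⊗ V.

(* id ⊗ R on (V ⊗ V) ⊗ V, transported along the associativity isomorphism. *)
Definition braid23 R (t : (V ⊗ V) ⊗ V) : (V ⊗ V) ⊗ V := tassocV (tmap id R (tassoc t)).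
Definition braid12 R (t : (V ⊗ V) ⊗ V) : (V ⊗ V) ⊗ V := tmap R id t.

Definition braiding R : Prop :=
  [/\ linear R, bijective R &
      forall t, braid23 R (braid12 R (braid23 R t)) =
                braid12 R (braid23 R (braid12 R t))].

(* h . (v ⊗ w) = \sum (h_(1) . v) ⊗ (h_(2) . w) *)
Definition diag_act (C : coalgType k) (a : C -> V -> V) (c : C) (t : V ⊗ V) : V ⊗ V :=
  tlift (fun c1 c2 => tmap (a c1) (a c2) t) (comul c).

(* The restriction of sigma(c) to V when sigma(c)(V) is contained in V; the    *)
(* witness is unique by tgen_inj.                                              *)
Definition restrict (C : Type) (sigma : C -> tensor_algebra V -> tensor_algebra V)
    (c : C) (v : V) : V :=
  xget 0 [set w | tgen w = sigma c (tgen v)]%classic.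

Definition preserves R (C : coalgType k)
    (sigma : C -> tensor_algebra V -> tensor_algebra V) : Prop :=
  (forall c v, exists w, sigma c (tgen v) = tgen w) /\
  (forall c v w, R (diag_act (restrict sigma) c (v ⊗ w)) =
                 diag_act (restrict sigma) c (R (v ⊗ w))).

Definition R_transformation_algebra R (P : bialgType k)
    (pi : P -> tensor_algebra V -> tensor_algebra V)
    (PR : bialgType k) (j : PR -> P) : Prop :=
  [/\ sub_bialgebra j,
      preserves R (fun p => pi (j p)) &
      forall (S : bialgType k) (i : S -> P),
        sub_bialgebra i -> preserves R (fun s => pi (i s)) ->
        forall s, exists p, i s = j p].

Definition HR_action R (H : bialgType k) (a : H -> V -> V) : Prop :=
  [/\ bilin a,
      forall v, a 1 v = v,
      forall g h v, a (g * h) v = a g (a h v) &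
      forall h t, R (diag_act a h t) = diag_act a h (R t)].

End Braiding.

Record category := Category {
  ob :> Type;
  hom : ob -> ob -> Type;
  idm : forall x, hom x x;
  comp : forall x y z, hom y z -> hom x y -> hom x z;
  comp_idl : forall x y (f : hom x y), comp (idm y) f = f;
  comp_idr : forall x y (f : hom x y), comp f (idm x) = f;
  comp_assoc : forall x y z w (f : hom z w) (g : hom y z) (h : hom x y),
    comp f (comp g h) = comp (comp f g) h
}.

Definition final_object (C : category) (x : C) : Prop :=
  forall y : C, exists f : hom y x, forall g : hom y x, g = f.

Section HR.
Variables (k : fieldType) (V : lmodType k) (R : V ⊗ V -> V ⊗ V).

Record HR_object := HRObject {
  HR_bialgebra :> bialgType k;
  HR_act : HR_bialgebra -> V -> V;
  HR_actP : HR_action R HR_act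
}.

Definition HR_morphism (X Y : HR_object) (f : X -> Y) : Prop :=
  bialgebra_morphism f /\ forall h v, HR_act (f h) v = HR_act h v.

Definition HR_hom (X Y : HR_object) := {f : X -> Y | HR_morphism f}.

Lemma HR_idP (X : HR_object) : HR_morphism (fun x : X => x).
Proof.
split=> //; split; first by split.
split=> // c; rewrite /tmap {1}[comul c]tensor_sum.
by apply: eq_bigr => x _.
Qed.

Lemma HR_compP (X Y Z : HR_object) (g : HR_hom Y Z) (f : HR_hom X Y) :
  HR_morphism (fun x => sval g (sval f x)).
Proof.
case: g f => g [[[lg g1 gM] [_ gD ge]] ga] [f [[[lf f1 fM] [_ fD fe]] fa]] /=.
split; last by move=> h v; rewrite ga fa.
split; split.
- by move=> a x y; rewrite lf lg.
- by rewrite f1 g1.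
- by move=> x y; rewrite fM gM.
- by move=> a x y; rewrite lf lg.
- move=> c; rewrite gD fD.
  have bg := tmap_bilin lg lg.
  pose G : {linear (Y ⊗ Y)%type -> (Z ⊗ Z)%type} :=
    HB.pack (tmap g g) (GRing.isLinear.Build _ _ _ _ _ (tlift_linear bg)).
  rewrite -[LHS]/(G _) {1}/tmap /tlift /tsum_eval linear_sum.
  by apply: eq_bigr => x _; rewrite linearZ /= /tmap tlift_tens.
- by move=> c; rewrite ge fe.
Qed.

Definition HR_id (X : HR_object) : HR_hom X X := exist _ _ (HR_idP X).

Definition HR_comp (X Y Z : HR_object) (g : HR_hom Y Z) (f : HR_hom X Y) : HR_hom X Z :=
  exist _ _ (HR_compP g f).

Lemma HR_hom_eq (X Y : HR_object) (f g : HR_hom X Y) : sval f = sval g -> f = g.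
Proof. by case: f g => f pf [g pg] /= e; apply: eq_exist. Qed.

Lemma HR_comp_idl (X Y : HR_object) (f : HR_hom X Y) : HR_comp (HR_id Y) f = f.
Proof. exact: HR_hom_eq. Qed.

Lemma HR_comp_idr (X Y : HR_object) (f : HR_hom X Y) : HR_comp f (HR_id X) = f.
Proof. exact: HR_hom_eq. Qed.

Lemma HR_comp_assoc (X Y Z W : HR_object)
    (f : HR_hom Z W) (g : HR_hom Y Z) (h : HR_hom X Y) :
  HR_comp f (HR_comp g h) = HR_comp (HR_comp f g) h.
Proof. exact: HR_hom_eq. Qed.

Definition HR : category := Category HR_comp_idl HR_comp_idr HR_comp_assoc.

End HR.

(* Main.v *)
(** Extend the action of H to the words in V by h.(v1 ... vn) = sum h_(1).v1 ... h_(n).vn.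
This measures TV, so it factors as pi o rho for a unique coalgebra map rho : H -> P(TV, TV).
The maps g ⊗ h |-> rho (g h) and g ⊗ h |-> rho g * rho h are coalgebra maps H ⊗ H -> P
whose measurings agree on the generators V, hence everywhere, so they are equal by
uniqueness: rho is a bialgebra map. Its image is a sub-bialgebra preserving (V, R), and is
therefore contained in P_R(V). Any other morphism H -> P_R(V) in H_R induces the same
measuring on V, hence on TV, and is equal to rho by uniqueness again. *)
From HB Require Import structures.
From mathcomp Require Import all_boot all_order all_algebra.
From mathcomp Require Import boolp classical_sets functions reals.
Require Import Defs.

Set Implicit Arguments.
Unset Strict Implicit.
Unset Printing Implicit Defensive.
Import GRing.Theory.
Local Open Scope classical_set_scope.
Local Open Scope ring_scope.


(** * Closure rules for linearity of maps that are not bundled *)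

Section LinearMaps.
Variable k : fieldType.
Implicit Types U V W X : lmodType k.

Lemma linear_sum_scale U V (f : U -> V) I (r : seq I) (a : I -> k) (u : I -> U) :
  linear f -> f (\sum_(i <- r) a i *: u i) = \sum_(i <- r) a i *: f (u i).
Proof.
move=> lf; pose g : {linear U -> V} := HB.pack f (GRing.isLinear.Build _ _ _ _ _ lf).
by rewrite -[LHS]/(g _) linear_sum; apply: eq_bigr => i _; rewrite linearZ.
Qed.

Lemma linear_scale U V (f : U -> V) a u : linear f -> f (a *: u) = a *: f u.
Proof.
move=> lf; pose g : {linear U -> V} := HB.pack f (GRing.isLinear.Build _ _ _ _ _ lf).
by rewrite -[LHS]/(g _) linearZ.
Qed.

Lemma linear_id U : linear (fun x : U => x).
Proof. by []. Qed.

Lemma linear_app U V W (g : V -> W) (f : U -> V) :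
  linear g -> linear f -> linear (fun x => g (f x)).
Proof. by move=> lg lf a x y; rewrite lf lg. Qed.

Lemma linear_bilinl U V W X (h : U -> V -> W) (f : X -> U) v :
  bilin h -> linear f -> linear (fun x => h (f x) v).
Proof. by move=> [bl _] lf a x y; rewrite lf bl. Qed.

Lemma linear_bilinr U V W X (h : U -> V -> W) (f : X -> V) u :
  bilin h -> linear f -> linear (fun x => h u (f x)).
Proof. by move=> [_ br] lf a x y; rewrite lf br. Qed.

Lemma linear_scalel U X (f : X -> k^o) (u : U) :
  linear f -> linear (fun x => (f x : k) *: u).
Proof. by move=> lf a x y; rewrite lf scalerDl -scalerA. Qed.

Lemma linear_scaler U X (f : X -> U) (b : k) :
  linear f -> linear (fun x => b *: f x).
Proof. by move=> lf a x y; rewrite lf scalerDr !scalerA mulrC. Qed.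

Lemma linear_mull (A : algType k) X (f : X -> A) (b : A) :
  linear f -> linear (fun x => f x * b).
Proof. by move=> lf a x y; rewrite lf mulrDl -scalerAl. Qed.

Lemma linear_mulr (A : algType k) X (f : X -> A) (b : A) :
  linear f -> linear (fun x => b * f x).
Proof. by move=> lf a x y; rewrite lf mulrDr -scalerAr. Qed.

(** The tensor [t] is fixed, so [tlift (F x) t] is a sum over one representative [repr t], with one
    term for each entry. Linearity in [x] is therefore inherited termwise. *)
Lemma linear_tlift_param U V W X (F : X -> U -> V -> W) (t : U ⊗ V) :
  (forall u v, linear (fun x => F x u v)) -> linear (fun x => tlift (F x) t).
Proof.
move=> lF a x y; rewrite /tlift /tsum_eval scaler_sumr -big_split /=.
by apply: eq_bigr => z _; rewrite lF scalerDr !scalerA mulrC.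
Qed.

Lemma linear_tens_l U V X (f : X -> U) (v : V) :
  linear f -> linear (fun x => f x ⊗ v).
Proof. exact/linear_bilinl/tens_bilin. Qed.

Lemma linear_tens_r U V X (f : X -> V) (u : U) :
  linear f -> linear (fun x => u ⊗ f x).
Proof. exact/linear_bilinr/tens_bilin. Qed.

Lemma linear_tlift U V W X (F : U -> V -> W) (f : X -> (U ⊗ V)%type) :
  bilin F -> linear f -> linear (fun x => tlift F (f x)).
Proof. by move=> bF; apply/linear_app/tlift_linear. Qed.

Lemma linear_comul (C : coalgType k) X (f : X -> C) :
  linear f -> linear (fun x => comul (f x)).
Proof. by apply: linear_app; exact: linearP. Qed.

Lemma linear_counit (C : coalgType k) X (f : X -> C) :
  linear f -> linear (fun x => counit (f x) : k^o).
Proof. by move=> lf a x y; rewrite lf linearP. Qed.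

End LinearMaps.

(** Proves [linear] and [bilin] goals by recursion on the body of the map. Facts about maps without
    a rule of their own are looked up among the hypotheses, which is why many proofs below first
    collect such facts with [have]. *)
Ltac lin :=
  intros; cbv beta;
  first
  [ assumption
  | match goal with |- bilin _ => split; lin end
  | match goal with H : bilin ?h |- linear _ =>
      first [exact (H.1 _) | exact (H.2 _)] end
  | apply: linear_id
  | apply: linear_tens_l; lin
  | apply: linear_tens_r; lin
  | apply: linear_scalel; lin
  | apply: linear_scaler; lin
  | apply: linear_mull; lin
  | apply: linear_mulr; lin
  | apply: linear_tlift_param; lin
  | apply: linear_tlift; lin
  | apply: linear_comul; lin
  | apply: linear_counit; lin
  | match goal with H : bilin ?h |- linear _ =>
      apply: (linear_bilinl _ H); lin end
  | match goal with H : linear ?h |- linear _ => apply: (linear_app H); lin end ].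

(** * Computing with maps out of a tensor product *)

Section TensorCalculus.
Variable k : fieldType.
Implicit Types U V W X : lmodType k.

Lemma linear_tliftE U V W X (L : W -> X) (f : U -> V -> W) t :
  linear L -> L (tlift f t) = tlift (fun u v => L (f u v)) t.
Proof. by move=> lL; rewrite /tlift /tsum_eval linear_sum_scale. Qed.

Lemma tens_ext U V W (f g : (U ⊗ V)%type -> W) : linear f -> linear g ->
  (forall u v, f (u ⊗ v) = g (u ⊗ v)) -> f =1 g.
Proof.
move=> lf lg fg t; rewrite [t]tensor_sum !linear_sum_scale //.
by apply: eq_bigr => x _; rewrite fg.
Qed.

Lemma tlift_id U V (t : U ⊗ V) : tlift (fun u v => u ⊗ v) t = t.
Proof. by rewrite [RHS]tensor_sum. Qed.

Lemma eq_tlift U V W (f g : U -> V -> W) t : (forall u v, f u v = g u v) ->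
  tlift f t = tlift g t.
Proof. by move=> fg; apply: eq_bigr => x _; rewrite fg. Qed.

Lemma tlift_tmap U V U' V' W (h : U' -> V' -> W) (f : U -> U') (g : V -> V') t :
  bilin h -> tlift h (tmap f g t) = tlift (fun u v => h (f u) (g v)) t.
Proof.
move=> bh; rewrite /tmap linear_tliftE; last exact: tlift_linear.
by apply: eq_tlift => u v; rewrite tlift_tens.
Qed.

Lemma tmap_tmap U V U' V' U'' V'' (f' : U' -> U'') (g' : V' -> V'') (f : U -> U')
    (g : V -> V') t : linear f' -> linear g' ->
  tmap f' g' (tmap f g t) = tmap (fun u => f' (f u)) (fun v => g' (g v)) t.
Proof. by move=> lf lg; rewrite {1}/tmap tlift_tmap //; exact: tmap_bilin. Qed.

Lemma tassoc_linear U V W : linear (@tassoc k U V W).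
Proof. apply: tlift_linear; lin. Qed.

End TensorCalculus.

(* Zorn's lemma for the graphs of partial retractions of i. The last clause of P holds
vacuously for the empty set, as Zorn_bigcup requires for the empty chain. *)
Lemma linear_retraction (k : fieldType) (U V : lmodType k) (i : U -> V) :
  linear i -> injective i -> exists2 r : V -> U, linear r & cancel i r.
Proof.
move=> li inji.
have i0 : i 0 = 0 by have := li (-1) 0 0; rewrite scaler0 addr0 scaleN1r addNr.
pose P (G : set (V * U)) := [/\ forall a x y, G x -> G y -> G (a *: x + y),
  forall u, G (0, u) -> u = 0 & forall x, G x -> forall u, G (i u, u)].
have [F FP Ftot|A [[Alin Afun Ai] Amax]] := @Zorn_bigcup _ P.
  split.
  - move=> a x y [G FG Gx] [G' FG' Gy].
    have [GG|GG] := Ftot _ _ FG FG'.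
      by exists G' => //; have [h _ _] := FP _ FG'; apply: h => //; apply: GG.
    by exists G => //; have [h _ _] := FP _ FG; apply: h => //; apply: GG.
  - by move=> u [G FG Gu]; have [_ h _] := FP _ FG; apply: h.
  - by move=> x [G FG Gx] u; exists G => //; have [_ _ h] := FP _ FG; apply: h Gx _.
have {}Ai u : A (i u, u).
  (* The maximal graph might be empty. In that case the graph of the inverse of [i] on its range is
     strictly larger and still satisfies [P]. *)
  have [[x Ax]|nA] := pselect (exists x, A x); first exact: Ai Ax _.
  exfalso; apply: (Amax [set x : V * U | x.1 = i x.2]).
    by split=> [x Ax|h]; case: nA; [exists x | exists (i u, u); apply: h].
  split=> [a x y /= xi yi|w /= wi|x _ w //]; first by rewrite li xi yi.
  by apply: inji; rewrite i0.
have A0 : A (0, 0) by rewrite -{1}i0; apply: Ai.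
have Adom v : exists u, A (v, u).
  apply: contrapT => nA.
  (* The graph is enlarged by a vector [v] outside its domain, which is sent to 0. *)
  pose B := [set x : V * U | exists a y, A y /\ x = (a *: v + y.1, y.2)].
  apply: (Amax B).
    split=> [x Ax|h]; first by exists 0, x; rewrite scale0r add0r; case: x Ax.
    by apply: nA; exists 0; apply: h; exists 1, (0, 0); rewrite scale1r addr0.
  split.
  - move=> a _ _ [b [x [Ax ->]]] [c [y [Ay ->]]].
    exists (a * b + c), (a *: x + y); split; first exact: Alin.
    by congr pair; rewrite /= scalerDr scalerDl !scalerA addrACA.
  - move=> u [a [[x w] [Ax /= [e ->]]]].
    (* Here [0 = a *: v + x] with [x] in the domain of [A]. If [a] were nonzero, [v] would be a
       multiple of [x] and so in the domain already. *)
    have [a0|a0] := eqVneq a 0.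
      by apply: Afun; rewrite e a0 scale0r add0r.
    exfalso; apply: nA; exists (- a^-1 *: w).
    have := Alin (- a^-1) _ _ Ax A0; rewrite addr0; congr (A (_, _)).
    have -> : x = - (a *: v) by apply/esym/eqP; rewrite eqr_oppLR -addr_eq0 -e.
    by rewrite scaleNr scalerN opprK scalerA mulVf // scale1r.
  - by move=> _ _ u; exists 0, (i u, u); rewrite scale0r add0r.
have [r Ar] := choice Adom.
have Auniq v u u' : A (v, u) -> A (v, u') -> u = u'.
  move=> h h'; have := Alin (-1) _ _ h h'; rewrite scaleN1r.
  have -> : - (v, u) + (v, u') = (0, u' - u) by congr pair; rewrite /= ?addNr // addrC.
  by move/Afun/eqP; rewrite subr_eq0 => /eqP.
exists r; last by move=> u; apply: Auniq (Ar _) (Ai _).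
by move=> a x y; apply: Auniq (Ar _) _; apply: Alin (Ar _) (Ar _).
Qed.

(** Over a field both maps have linear left inverses, and the tensor product of these is a left
    inverse of [tmap i j]. This allows identities in [S ⊗ S] to be checked in [P ⊗ P] when [S]
    embeds in [P]. *)
Lemma tmap_inj (k : fieldType) (U V U' V' : lmodType k) (i : U -> U') (j : V -> V') :
  linear i -> linear j -> injective i -> injective j -> injective (tmap i j).
Proof.
move=> li lj /(linear_retraction li)[r lr ri] /(linear_retraction lj)[s ls sj].
apply: (can_inj (g := tmap r s)) => t; rewrite tmap_tmap // -[RHS]tlift_id.
by apply: eq_tlift => u v; rewrite ri sj.
Qed.

(** * Interchange of the two middle factors in a fourfold tensor product *)

Section Shuffle.
Variable k : fieldType.
Implicit Types U V W : lmodType k.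

Lemma tens_ext2 U V U' V' W (f g : (U ⊗ V)%type -> (U' ⊗ V')%type -> W) :
  bilin f -> bilin g ->
  (forall u v u' v', f (u ⊗ v) (u' ⊗ v') = g (u ⊗ v) (u' ⊗ v')) ->
  forall s t, f s t = g s t.
Proof.
move=> [fl fr] [gl gr] fg s t; apply: (tens_ext (fl t) (gl t)) => u v.
by apply: (tens_ext (fr _) (gr _)) => u' v'; apply: fg.
Qed.

(** The isomorphism [(U ⊗ V) ⊗ (U' ⊗ V') -> (U ⊗ U') ⊗ (V ⊗ V')], kept as a bilinear map of two
    arguments so that [tens_ext2] applies to it. *)
Definition tshuffle U V U' V' (s : U ⊗ V) (t : U' ⊗ V') : (U ⊗ U') ⊗ (V ⊗ V') :=
  tlift (fun u v => tlift (fun u' v' => (u ⊗ u') ⊗ (v ⊗ v')) t) s.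

Lemma tshuffle_bilin U V U' V' : bilin (@tshuffle U V U' V').
Proof. rewrite /tshuffle; lin. Qed.

Lemma tshuffle_tens U V U' V' (u : U) (v : V) (u' : U') (v' : V') :
  tshuffle (u ⊗ v) (u' ⊗ v') = (u ⊗ u') ⊗ (v ⊗ v').
Proof. rewrite /tshuffle !tlift_tens //; lin. Qed.

Lemma tmul_bilin (A B : algType k) : bilin (@tmul k A B).
Proof. rewrite /tmul; lin. Qed.

End Shuffle.

(** * The tensor product of two coalgebras as a coalgebra *)

Section TensorCoalgebra.
Variables (k : fieldType) (C D : coalgType k).

Lemma tens_scale (U V : lmodType k) (a b : k) (u : U) (v : V) :
  (a *: u) ⊗ (b *: v) = (a * b) *: (u ⊗ v).
Proof.
have [bl br] := tens_bilin U V.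
by rewrite (linear_scale _ _ (bl _)) (linear_scale _ _ (br _)) scalerA.
Qed.

Definition tens_comul (z : C ⊗ D) : (C ⊗ D) ⊗ (C ⊗ D) :=
  tlift (fun c d => tshuffle (comul c) (comul d)) z.

Definition tens_counit (z : C ⊗ D) : k :=
  @tlift k C D k^o (fun c d => counit c * counit d) z.

Let sh := @tshuffle_bilin k.

Let comul_bilin : bilin (fun (c : C) (d : D) => tshuffle (comul c) (comul d)).
Proof. have b := sh C C D D; lin. Qed.

Let counit_bilin : @bilin k C D k^o (fun c d => counit c * counit d).
Proof. lin. Qed.

Fact tens_comul_linear : linear tens_comul.
Proof. exact: tlift_linear. Qed.

Fact tens_counit_linear : linear_for *%R tens_counit.
Proof. exact: (@tlift_linear k C D k^o _ counit_bilin). Qed.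

Lemma tens_comulE c d : tens_comul (c ⊗ d) = tshuffle (comul c) (comul d).
Proof. exact: tlift_tens. Qed.

Lemma tens_counitE c d : tens_counit (c ⊗ d) = counit c * counit d.
Proof. exact: (@tlift_tens k C D k^o). Qed.

HB.instance Definition _ :=
  GRing.isLinear.Build k (C ⊗ D)%type ((C ⊗ D) ⊗ (C ⊗ D))%type _ tens_comul
    tens_comul_linear.

HB.instance Definition _ :=
  GRing.isLinear.Build k (C ⊗ D)%type k _ tens_counit tens_counit_linear.

(** The interchange for threefold products, [u ⊗ (v ⊗ w)] and [u' ⊗ (v' ⊗ w')] giving
    [(u ⊗ u') ⊗ ((v ⊗ v') ⊗ (w ⊗ w'))]. *)
Let shuffle3 (U V W U' V' W' : lmodType k) (s : U ⊗ (V ⊗ W)) (t : U' ⊗ (V' ⊗ W')) :=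
  tlift (fun u s' => tlift (fun u' t' => (u ⊗ u') ⊗ tshuffle s' t') t) s.

Let shuffle3_bilin (U V W U' V' W' : lmodType k) :
  bilin (@shuffle3 U V W U' V' W').
Proof. have b := sh V W V' W'; rewrite /shuffle3; lin. Qed.

Let shuffle3_tens (U V W U' V' W' : lmodType k) (u : U) s (u' : U') t :
  @shuffle3 U V W U' V' W' (u ⊗ s) (u' ⊗ t) = (u ⊗ u') ⊗ tshuffle s t.
Proof. have b := sh V W V' W'; rewrite /shuffle3 !tlift_tens //; lin. Qed.

Let shuffle_assoc (U V W U' V' W' : lmodType k) s t (w : W) (w' : W') :
  tassoc (@tshuffle k U V U' V' s t ⊗ (w ⊗ w')) =
  shuffle3 (tassoc (s ⊗ w)) (tassoc (t ⊗ w')).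
Proof.
have b := sh U V U' V'; have b3 := @shuffle3_bilin U V W U' V' W'.
have l1 := @tassoc_linear k U V W; have l2 := @tassoc_linear k U' V' W'.
have l3 := @tassoc_linear k (U ⊗ U')%type (V ⊗ V')%type (W ⊗ W')%type.
move: s t; apply: tens_ext2 => [||u v u' v']; [lin|lin|].
by rewrite tshuffle_tens !tassoc_tens shuffle3_tens tshuffle_tens.
Qed.

Fact tens_comulA z : tassoc (tmap tens_comul id (tens_comul z)) =
  tmap id tens_comul (tens_comul z).
Proof.
have lT := tens_comul_linear; have lC := @linear_comul k C _ _ (@linear_id k C).
have lD := @linear_comul k D _ _ (@linear_id k D).
have b := sh C C D D; have b3 := @shuffle3_bilin C C C D D D.
have l1 := @tassoc_linear k C C C; have l2 := @tassoc_linear k D D D.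
have l3 := @tassoc_linear k (C ⊗ D)%type (C ⊗ D)%type (C ⊗ D)%type.
move: z; apply: tens_ext => [||c d]; [lin|lin|].
rewrite tens_comulE.
(* Both sides turn into [shuffle3] of an element coming from [C] and one coming from [D];
   coassociativity of [C] and of [D] identifies them. *)
have -> s t : tassoc (tmap tens_comul id (tshuffle s t)) =
    shuffle3 (tassoc (tmap (comul : C -> _) id s)) (tassoc (tmap (comul : D -> _) id t)).
  move: s t; apply: tens_ext2 => [||c1 c2 d1 d2]; [lin|lin|].
  rewrite tshuffle_tens !tmap_tens ?tens_comulE ?shuffle_assoc //; lin.
have -> s t : tmap id tens_comul (tshuffle s t) =
    shuffle3 (tmap id (comul : C -> _) s) (tmap id (comul : D -> _) t).
  move: s t; apply: tens_ext2 => [||c1 c2 d1 d2]; [lin|lin|].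
  rewrite tshuffle_tens !tmap_tens ?tens_comulE ?shuffle3_tens //; lin.
by rewrite !comulA.
Qed.

(** Splits a sum over the coproduct of [c ⊗ d] into one over [comul c] and one over [comul d], which
    reduces the counit laws of [C ⊗ D] to those of the factors. *)
Lemma tlift_shuffle (U V : lmodType k) (f : C -> C -> U) (g : D -> D -> V)
    (h : (C ⊗ D)%type -> (C ⊗ D)%type -> (U ⊗ V)%type) s t :
  bilin h -> bilin f -> bilin g ->
  (forall c c' d d', h (c ⊗ d) (c' ⊗ d') = f c c' ⊗ g d d') ->
  tlift h (tshuffle s t) = tlift f s ⊗ tlift g t.
Proof.
move=> bh bf bg e; have b := sh C C D D.
move: s t; apply: tens_ext2 => [||c c' d d']; [lin|lin|].
by rewrite tshuffle_tens !tlift_tens.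
Qed.

Fact tens_counitl z : tlift (fun x y => tens_counit x *: y) (tens_comul z) = z.
Proof.
have lT := tens_comul_linear; have le : linear (tens_counit : _ -> k^o) := tens_counit_linear.
move: z; apply: tens_ext => [||c d]; [lin|lin|]; rewrite tens_comulE.
rewrite (@tlift_shuffle _ _ (fun x y => counit x *: y) (fun x y => counit x *: y));
  [by rewrite !counitl | lin | lin | lin |].
by move=> c1 c2 d1 d2; rewrite tens_counitE tens_scale.
Qed.

Fact tens_counitr z : tlift (fun x y => tens_counit y *: x) (tens_comul z) = z.
Proof.
have lT := tens_comul_linear; have le : linear (tens_counit : _ -> k^o) := tens_counit_linear.
move: z; apply: tens_ext => [||c d]; [lin|lin|]; rewrite tens_comulE.
rewrite (@tlift_shuffle _ _ (fun x y => counit y *: x) (fun x y => counit y *: x));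
  [by rewrite !counitr | lin | lin | lin |].
by move=> c1 c2 d1 d2; rewrite tens_counitE tens_scale.
Qed.

HB.instance Definition _ := Lmodule_isCoalgebra.Build k (C ⊗ D)%type
  tens_comulA tens_counitl tens_counitr.

End TensorCoalgebra.

(** * Coalgebra morphisms built from tensor products, multiplication and group-like elements *)

Section CoalgebraMorphisms.
Variable k : fieldType.
Implicit Types C D E : coalgType k.

Lemma comul_tens C D (c : C) (d : D) :
  comul (c ⊗ d) = tshuffle (comul c) (comul d).
Proof. exact: tens_comulE. Qed.

Lemma counit_tens C D (c : C) (d : D) : counit (c ⊗ d) = counit c * counit d.
Proof. exact: tens_counitE. Qed.

Lemma coalgebra_morphism_comp C D E (g : D -> E) (f : C -> D) :
  coalgebra_morphism g -> coalgebra_morphism f -> coalgebra_morphism (fun c => g (f c)).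
Proof.
move=> [lg gD ge] [lf fD fe]; split=> [|c|c]; first by lin.
  by rewrite gD fD tmap_tmap.
by rewrite ge fe.
Qed.

Lemma coalgebra_morphism_tmap C D C' D' (f : C -> C') (g : D -> D') :
  coalgebra_morphism f -> coalgebra_morphism g ->
  coalgebra_morphism (tmap f g : (C ⊗ D)%type -> (C' ⊗ D')%type).
Proof.
move=> [lf fD fe] [lg gD ge]; split; first by lin.
  have b := @tshuffle_bilin k C C D D; have b' := @tshuffle_bilin k C' C' D' D'.
  apply: tens_ext => [||c d]; [lin|lin|].
  rewrite tmap_tens // !comul_tens fD gD.
  move: (comul c) (comul d); apply: tens_ext2 => [||c1 c2 d1 d2]; [lin|lin|].
  rewrite !(tshuffle_tens, tmap_tens) //; lin.
move=> z; apply: (@tens_ext _ C D k^o (fun z => counit (tmap f g z)) (fun z => counit z)).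
- lin.
- lin.
- by move=> c d; rewrite tmap_tens // !counit_tens fe ge.
Qed.

Definition tens_mul (A : algType k) (z : A ⊗ A) : A := tlift (fun a b => a * b) z.

Lemma mul_bilin (A : algType k) : bilin (fun a b : A => a * b).
Proof. lin. Qed.

Lemma tens_mulE (A : algType k) (a b : A) : tens_mul (a ⊗ b) = a * b.
Proof. exact/tlift_tens/mul_bilin. Qed.

(** This is the content of [comulM] and [counitM]: the product [tmul] is the interchange [tshuffle]
    followed by [tens_mul] on each factor. *)
Lemma coalgebra_morphism_mul (H : bialgType k) :
  coalgebra_morphism (@tens_mul H : (H ⊗ H)%type -> H).
Proof.
have lm : linear (@tens_mul H) by exact/tlift_linear/mul_bilin.
have b := @tshuffle_bilin k H H H H; have bm := @tmul_bilin k H H.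
split=> //.
  apply: tens_ext => [||g h]; [lin|lin|].
  rewrite tens_mulE comulM comul_tens.
  move: (comul g) (comul h); apply: tens_ext2 => [||c1 c2 d1 d2]; [lin|lin|].
  by rewrite tmul_tens tshuffle_tens tmap_tens // !tens_mulE.
move=> z; apply: (@tens_ext _ H H k^o (fun z => counit (tens_mul z)) (fun z => counit z)).
- lin.
- lin.
- by move=> g h; rewrite tens_mulE counit_tens counitM.
Qed.

(** The counit of [C] followed by the coalgebra map from [k] to [D] sending 1 to [g]. It turns an
    equation between group-like elements into one between coalgebra maps, to which the universal
    property applies. *)
Lemma coalgebra_morphism_grouplike C D (g : D) : comul g = g ⊗ g -> counit g = 1 ->
  coalgebra_morphism (fun c : C => counit c *: g).
Proof.
move=> gD ge; split=> [|c|c]; first by lin.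
  (* The counit law expands [counit c] as the sum of [counit x * counit y] over the coproduct of
     [c], the coefficients found on the other side. *)
  rewrite linearZ /= gD /tmap -[in LHS](counitl c).
  rewrite (linear_tliftE _ (L := fun x => counit x *: (g ⊗ g))); last by lin.
  apply: eq_tlift => x y.
  by rewrite tens_scale -[LHS]/(counit _ *: _) linearZ.
by rewrite linearZ /= ge mulr1.
Qed.

End CoalgebraMorphisms.

(** * Measuring maps on a tensor algebra *)

Section Measuring.
Variables (k : fieldType) (V : lmodType k).
Local Notation TV := (tensor_algebra V).

Lemma measuring_comp (C D : coalgType k) (A B : algType k) (sigma : D -> A -> B)
    (f : C -> D) :
  measuring sigma -> coalgebra_morphism f -> measuring (fun c => sigma (f c)).
Proof.
move=> [bs sM s1] [lf fD fe]; split=> [|c a a'|c]; first by lin.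
  by rewrite sM fD tlift_tmap //; lin.
by rewrite s1 fe.
Qed.

(** Induction on words: the product rule passes from [v s] to the generator [v] and the shorter word
    [s], and the empty word is fixed by the counit. The element [c] is generalized because [s] is
    acted on by its second component. *)
Lemma measuring_ext (C : coalgType k) (B : algType k) (sigma tau : C -> TV -> B) :
  measuring sigma -> measuring tau ->
  (forall c v, sigma c (tgen v) = tau c (tgen v)) -> forall c t, sigma c t = tau c t.
Proof.
move=> [bs sM s1] [bt tM t1] e c t.
have [_ ls] := bs; have [_ lt] := bt.
rewrite [t]talg_sum !linear_sum_scale //; apply: eq_bigr => x _; congr (_ *: _).
elim: x.2 c => [|v s IHs] c; first by rewrite !big_nil s1 t1.
by rewrite !big_cons sM tM; apply: eq_tlift => c1 c2; rewrite e IHs.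
Qed.

End Measuring.

(** * The convolution algebra of linear maps from [H] to [B] *)

Section Convolution.
Variables (k : fieldType) (H : bialgType k) (B : algType k).

Definition linear_fun : {pred H -> B} := fun f => `[< linear f >].

Fact linear_fun_submod_closed : submod_closed linear_fun.
Proof.
split=> [|a f g /asboolP lf /asboolP lg]; apply/asboolP => b x y.
  by rewrite /= scaler0 addr0.
have E u : (a *: f + g) u = a *: f u + g u by [].
by rewrite !E lf lg !scalerDr !scalerA addrACA mulrC.
Qed.

HB.instance Definition _ :=
  GRing.isSubmodClosed.Build k (H -> B) linear_fun linear_fun_submod_closed.

(** Linear maps form a subtype, so that the module structure comes from that of all functions and
    the result can be an [algType], the kind of target that [talg_lift] requires. *)
Record convolution := Convolution {
  conv_fun :> H -> B;
  conv_funP : conv_fun \in linear_fun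
}.

HB.instance Definition _ := [isSub for conv_fun].
HB.instance Definition _ := [Choice of convolution by <:].
HB.instance Definition _ := [SubChoice_isSubLmodule of convolution by <:].

Lemma conv_linear (f : convolution) : linear f.
Proof. by have /asboolP := conv_funP f. Qed.

Lemma convP (f g : convolution) : (forall c, f c = g c) -> f = g.
Proof. by move=> e; apply/val_inj/funext. Qed.

Lemma convD (f g : convolution) c : (f + g) c = f c + g c.
Proof. by []. Qed.

Lemma convZ (a : k) (f : convolution) c : (a *: f) c = a *: f c.
Proof. by []. Qed.

Lemma mk_conv (f : H -> B) : linear f -> f \in linear_fun.
Proof. by move=> lf; apply/asboolP. Qed.

Fact conv_one_linear : linear (fun c : H => counit c *: (1 : B)).
Proof. lin. Qed.

Fact conv_mul_linear (f g : convolution) :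
  linear (fun c : H => tlift (fun x y => f x * g y) (comul c)).
Proof. have lf := conv_linear f; have lg := conv_linear g; lin. Qed.

Definition conv_one := Convolution (mk_conv conv_one_linear).
Definition conv_mul f g := Convolution (mk_conv (conv_mul_linear f g)).

Fact conv_mulA : associative conv_mul.
Proof.
move=> f g h; have lf := conv_linear f; have lg := conv_linear g.
have lh := conv_linear h; apply: convP => c /=.
have lD := @linear_comul k H _ _ (@linear_id k H).
(* [T] is the triple product read on [H ⊗ (H ⊗ H)]. The left side is [T] of one iterated coproduct,
   and [comulA] exchanges it for the other. *)
pose T (s : H ⊗ (H ⊗ H)) := tlift (fun x s => f x * tlift (fun y z => g y * h z) s) s.
have lT : linear T by rewrite /T; lin.
have -> : tlift (fun x y => f x * tlift (fun x y => g x * h y) (comul y)) (comul c)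
    = T (tmap id comul (comul c)) by rewrite /T tlift_tmap //; lin.
rewrite -comulA; move: (comul c).
have la := @tassoc_linear k H H H.
apply: tens_ext => [||x y]; [lin|lin|].
rewrite tlift_tens ?tmap_tens //; [|lin..]; move: (comul x).
apply: tens_ext => [||x1 x2]; [lin|lin|].
by rewrite tassoc_tens /T !tlift_tens ?mulrA //; lin.
Qed.

Fact conv_mul1l : left_id conv_one conv_mul.
Proof.
move=> f; apply: convP => c /=; rewrite -[in RHS](counitl c).
rewrite linear_tliftE; last exact: conv_linear.
by apply: eq_tlift => x y; rewrite -scalerAl mul1r linear_scale //; apply: conv_linear.
Qed.

Fact conv_mul1r : right_id conv_one conv_mul.
Proof.
move=> f; apply: convP => c /=; rewrite -[in RHS](counitr c).
rewrite linear_tliftE; last exact: conv_linear.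
by apply: eq_tlift => x y; rewrite -scalerAr mulr1 linear_scale //; apply: conv_linear.
Qed.

Fact conv_mulDl : left_distributive conv_mul +%R.
Proof.
move=> f g h; apply: convP => c; rewrite convD /= /tlift /tsum_eval -big_split /=.
by apply: eq_bigr => x _; rewrite mulrDl scalerDr.
Qed.

Fact conv_mulDr : right_distributive conv_mul +%R.
Proof.
move=> f g h; apply: convP => c; rewrite convD /= /tlift /tsum_eval -big_split /=.
by apply: eq_bigr => x _; rewrite mulrDr scalerDr.
Qed.

(** Evaluation at the unit of [H], where the counit is 1, separates the two. The zero coalgebra
    would give the zero ring. *)
Fact conv_one_neq0 : conv_one != 0.
Proof.
apply/eqP => /(congr1 (fun f : convolution => f 1)).
by rewrite /= counit1 scale1r => /eqP; rewrite oner_eq0.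
Qed.

HB.instance Definition _ := GRing.Zmodule_isNzRing.Build convolution
  conv_mulA conv_mul1l conv_mul1r conv_mulDl conv_mulDr conv_one_neq0.

Fact conv_scaleAl (a : k) (f g : convolution) : a *: (f * g) = (a *: f) * g.
Proof.
apply: convP => c; rewrite convZ /= /tlift /tsum_eval scaler_sumr; apply: eq_bigr => x _ /=.
by rewrite -scalerAl !scalerA mulrC.
Qed.

Fact conv_scaleAr (a : k) (f g : convolution) : a *: (f * g) = f * (a *: g).
Proof.
apply: convP => c; rewrite convZ /= /tlift /tsum_eval scaler_sumr; apply: eq_bigr => x _ /=.
by rewrite -scalerAr !scalerA mulrC.
Qed.

HB.instance Definition _ := GRing.Lmodule_isLalgebra.Build k convolution conv_scaleAl.
HB.instance Definition _ := GRing.Lalgebra_isAlgebra.Build k convolution conv_scaleAr.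

End Convolution.

(* Measuring maps H -> Hom(A, B) are algebra maps A -> Hom(H, B) for convolution. *)
Lemma measuring_extension (k : fieldType) (V : lmodType k) (H : bialgType k)
    (B : algType k) (a : H -> V -> B) : bilin a ->
  exists2 sigma : H -> tensor_algebra V -> B,
    measuring sigma & forall h v, sigma h (tgen v) = a h v.
Proof.
move=> ba; pose f v : convolution H B := Convolution (mk_conv (ba.1 v)).
have lf : linear f by move=> b u v; apply: convP => h; apply: ba.2.
have [ll l1 lM] := talg_lift_morphism lf.
exists (fun h t => talg_lift f t h); last by move=> h v; rewrite talg_lift_tgen.
split.
- split=> [t|h b s t]; first exact: conv_linear.
  by rewrite ll.
- by move=> h s t; rewrite lM.
- by move=> h; rewrite l1.
Qed.

(** * The image of a bialgebra morphism as a sub-bialgebra *)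

Lemma tassoc_tmap (k : fieldType) (U V W U' V' W' : lmodType k)
    (f : U -> U') (g : V -> V') (h : W -> W') t :
  linear f -> linear g -> linear h ->
  tassoc (tmap (tmap f g) h t) = tmap f (tmap g h) (tassoc t).
Proof.
move=> lf lg lh; have l := @tassoc_linear k U V W; have l' := @tassoc_linear k U' V' W'.
move: t; apply: tens_ext => [||s w]; [lin|lin|].
rewrite tmap_tens //; last by lin.
move: s; apply: tens_ext => [||u v]; [lin|lin|].
by rewrite tmap_tens // !tassoc_tens !tmap_tens //; lin.
Qed.

Section Image.
Variables (k : fieldType) (H P : bialgType k).
(** The map is packaged with its proof so that the type [image] determines both, and the structures
    declared on it can be inferred from the type alone. *)
Variable rho : {f : H -> P | bialgebra_morphism f}.
Local Notation f := (sval rho).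

Let lf : linear f. Proof. by case: (svalP rho) => -[]. Qed.
Let f1 : f 1 = 1. Proof. by case: (svalP rho) => -[]. Qed.
Let fM : {morph f : x y / x * y}. Proof. by case: (svalP rho) => -[]. Qed.
Let fD c : comul (f c) = tmap f f (comul c). Proof. by case: (svalP rho) => _ []. Qed.
Let fe c : counit (f c) = counit c. Proof. by case: (svalP rho) => _ []. Qed.

Definition in_image : {pred P} := fun p => `[< exists h, f h = p >].

Fact in_image_subalg_closed : subalg_closed in_image.
Proof.
split=> [|a p q|p q]; first by apply/asboolP; exists 1; rewrite f1.
  move=> /asboolP[g <-] /asboolP[h <-]; apply/asboolP.
  by exists (a *: g + h); rewrite lf.
by move=> /asboolP[g <-] /asboolP[h <-]; apply/asboolP; exists (g * h); rewrite fM.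
Qed.

HB.instance Definition _ :=
  GRing.isSubalgClosed.Build k P in_image in_image_subalg_closed.

Record image := Image { image_val :> P; image_valP : image_val \in in_image }.

HB.instance Definition _ := [isSub for image_val].
HB.instance Definition _ := [Choice of image by <:].
HB.instance Definition _ := [SubChoice_isSubAlgebra of image by <:].

Lemma in_image_f h : f h \in in_image.
Proof. by apply/asboolP; exists h. Qed.

Definition to_image h : image := Image (in_image_f h).

Lemma to_image_surj s : exists h, to_image h = s.
Proof. by case: s => p h; have /asboolP[x e] := h; exists x; apply: val_inj. Qed.

Lemma image_val_linear : linear image_val.
Proof. by move=> a s t; rewrite -[image_val]/(val : image -> P) linearP. Qed.

Lemma image_val_inj : injective image_val.
Proof. exact: val_inj. Qed.

Lemma to_image_linear : linear to_image.
Proof. by move=> a s t; apply: val_inj; rewrite linearP /= lf. Qed.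

Lemma to_image1 : to_image 1 = 1.
Proof. by apply: val_inj; rewrite rmorph1. Qed.

Lemma to_imageM : {morph to_image : x y / x * y}.
Proof. by move=> x y; apply: val_inj; rewrite rmorphM /= fM. Qed.

(* The choice of representatives is immaterial (image_comulE), because i ⊗ i is
injective when i : image -> P is, k being a field. *)
Definition image_rep (s : image) : H := sval (cid (to_image_surj s)).

Definition image_comul (s : image) : image ⊗ image :=
  tmap to_image to_image (comul (image_rep s)).

Definition image_counit (s : image) : k := counit (image_val s).

Let lq := to_image_linear.

(** Since [to_image] is surjective, this formula reduces the coalgebra and bialgebra axioms for the
    new coproduct to those of [H], pushed forward along [to_image]. *)
Lemma image_comulE h : image_comul (to_image h) = tmap to_image to_image (comul h).
Proof.
have lv := image_val_linear.
apply: (tmap_inj lv lv image_val_inj image_val_inj); rewrite !tmap_tmap //.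
(* In [P ⊗ P] both sides are coproducts of values of [f], at the chosen preimage and at [h]; these
   values coincide. *)
rewrite -[LHS]/(tmap f f _) -[RHS]/(tmap f f _) -!fD.
suff -> : f (image_rep (to_image h)) = f h by [].
by rewrite /image_rep; case: cid => g /= /(congr1 image_val).
Qed.

Lemma image_counitE h : image_counit (to_image h) = counit h.
Proof. exact: fe. Qed.

Fact image_comul_linear : linear image_comul.
Proof.
move=> a s t; have [g <-] := to_image_surj s; have [h <-] := to_image_surj t.
rewrite -lq !image_comulE linearP.
by apply: tlift_linear; apply: tmap_bilin.
Qed.

Fact image_counit_linear : linear_for *%R image_counit.
Proof. by move=> a s t; rewrite /image_counit image_val_linear linearP. Qed.

HB.instance Definition _ :=
  GRing.isLinear.Build k image (image ⊗ image)%type _ image_comul image_comul_linear.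
HB.instance Definition _ :=
  GRing.isLinear.Build k image k _ image_counit image_counit_linear.

Fact image_comulA s :
  tassoc (tmap image_comul id (image_comul s)) = tmap id image_comul (image_comul s).
Proof.
have [h <-] := to_image_surj s; have lD := image_comul_linear.
have lc := @linear_comul k H _ _ (@linear_id k H).
have lqq : linear (tmap to_image to_image) by lin.
rewrite image_comulE !tmap_tmap //.
have -> : (fun u => image_comul (to_image u)) =
    (fun u => tmap to_image to_image (comul u)) by apply/funext => u; exact: image_comulE.
transitivity (tassoc (tmap (tmap to_image to_image) to_image (tmap comul id (comul h)))).
  by rewrite tmap_tmap.
by rewrite tassoc_tmap // comulA tmap_tmap.
Qed.

Fact image_counitl s : tlift (fun x y => image_counit x *: y) (image_comul s) = s.
Proof.
have [h <-] := to_image_surj s; rewrite image_comulE.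
have le : linear (image_counit : _ -> k^o) := image_counit_linear.
rewrite tlift_tmap; last by lin.
rewrite -[in RHS](counitl h) linear_tliftE //; apply: eq_tlift => x y.
by rewrite image_counitE linear_scale.
Qed.

Fact image_counitr s : tlift (fun x y => image_counit y *: x) (image_comul s) = s.
Proof.
have [h <-] := to_image_surj s; rewrite image_comulE.
have le : linear (image_counit : _ -> k^o) := image_counit_linear.
rewrite tlift_tmap; last by lin.
rewrite -[in RHS](counitr h) linear_tliftE //; apply: eq_tlift => x y.
by rewrite image_counitE linear_scale.
Qed.

HB.instance Definition _ := Lmodule_isCoalgebra.Build k image
  image_comulA image_counitl image_counitr.

Fact image_comul1 : comul (1 : image) = 1 ⊗ 1.
Proof. by rewrite -to_image1 [LHS]image_comulE comul1 tmap_tens // to_image1. Qed.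

Fact image_comulM (s t : image) : comul (s * t) = tmul (comul s) (comul t).
Proof.
have [g <-] := to_image_surj s; have [h <-] := to_image_surj t.
rewrite -to_imageM [LHS]image_comulE comulM.
rewrite -[comul (to_image g)]/(image_comul _) -[comul (to_image h)]/(image_comul _).
rewrite !image_comulE.
have b := @tmul_bilin k H H; have b' := @tmul_bilin k image image.
move: (comul g) (comul h); apply: tens_ext2 => [||x y x' y']; [lin|lin|].
by rewrite !(tmul_tens, tmap_tens) // !to_imageM.
Qed.

Fact image_counit1 : counit (1 : image) = 1.
Proof. by rewrite -to_image1 [LHS]image_counitE counit1. Qed.

Fact image_counitM (s t : image) : counit (s * t) = counit s * counit t.
Proof.
have [g <-] := to_image_surj s; have [h <-] := to_image_surj t.
by rewrite -to_imageM -![counit (to_image _)]/(image_counit _) !image_counitE counitM.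
Qed.

HB.instance Definition _ := Algebra_Coalgebra_isBialgebra.Build k image
  image_comul1 image_comulM image_counit1 image_counitM.

Lemma image_val_sub_bialgebra : sub_bialgebra image_val.
Proof.
split; last exact: image_val_inj.
have lv := image_val_linear.
split; split=> // s; have [h <-] := to_image_surj s.
by rewrite fD [comul (to_image h)]image_comulE tmap_tmap.
Qed.

End Image.

(** The maximality of [P_R(V)] speaks of sub-bialgebras only, so a bialgebra map is factored as a
    surjection followed by the inclusion of one. *)
Lemma bialgebra_morphism_image (k : fieldType) (H P : bialgType k) (rho : H -> P) :
  bialgebra_morphism rho ->
  exists (S : bialgType k) (i : S -> P) (q : H -> S),
    [/\ sub_bialgebra i, coalgebra_morphism q, forall s, exists h, q h = s &
        forall h, i (q h) = rho h].
Proof.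
move=> mr; pose r := exist _ _ mr.
exists (image r), (@image_val _ _ _ r), (to_image r); split=> //.
- exact: image_val_sub_bialgebra.
- split; [exact: to_image_linear | exact: image_comulE | exact: image_counitE].
- exact: to_image_surj.
Qed.

(** * Restriction to [V] and the diagonal action on [V ⊗ V] *)

Section Actions.
Variables (k : fieldType) (V : lmodType k).
Local Notation TV := (tensor_algebra V).

Lemma restrictE (T : Type) (sigma : T -> TV -> TV) c v w :
  sigma c (tgen v) = tgen w -> restrict sigma c v = w.
Proof.
move=> e; apply: xget_unique => [|u /=]; first exact: esym.
by rewrite e => /tgen_inj.
Qed.

Lemma tgen_restrict (T : Type) (sigma : T -> TV -> TV) c v :
  (exists w, sigma c (tgen v) = tgen w) ->
  tgen (restrict sigma c v) = sigma c (tgen v).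
Proof. by move=> [w e]; rewrite (restrictE e). Qed.

Lemma restrict_bilin (C : lmodType k) (sigma : C -> TV -> TV) : bilin sigma ->
  (forall c v, exists w, sigma c (tgen v) = tgen w) -> bilin (restrict sigma).
Proof.
move=> bs st; have lt := @tgen_linear k V.
by split=> [v a c d|c a u v]; apply: tgen_inj; rewrite lt !tgen_restrict //;
  [apply: bs.1 | rewrite lt bs.2].
Qed.

Lemma diag_act_linear (C : coalgType k) (a : C -> V -> V) (c : C) :
  (forall c, linear (a c)) -> linear (diag_act a c).
Proof.
move=> la; apply: linear_tlift_param => c1 c2.
have l1 := la c1; have l2 := la c2; lin.
Qed.

Lemma diag_act_morphism (C D : coalgType k) (a : D -> V -> V) (q : C -> D) c t :
  coalgebra_morphism q -> bilin a ->
  diag_act a (q c) t = diag_act (fun c => a (q c)) c t.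
Proof.
move=> [lq qD _] ba; rewrite /diag_act qD tlift_tmap //.
by rewrite /tmap; lin.
Qed.

End Actions.

(** * Consequences of uniqueness in the universal property *)

Section Universal.
Variables (k : fieldType) (A : algType k) (P : bialgType k) (pi : P -> A -> A).
Hypothesis hP : universal_measuring_bialgebra pi.

(** Both [f] and [g] are factorizations of the single measuring map [fun c => pi (f c)]. *)
Lemma universal_measuring_inj (C : coalgType k) (f g : C -> P) :
  coalgebra_morphism f -> coalgebra_morphism g ->
  (forall c a, pi (f c) a = pi (g c) a) -> forall c, f c = g c.
Proof.
move=> mf mg e c; have [[mpi uni] _ _] := hP.
have [rho [_ _ r]] := uni C _ (measuring_comp mpi mf).
rewrite (r f mf) // (r g mg) // => x.
by apply/funext => a; apply: e.
Qed.

End Universal.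

(** Compatibility with units and products becomes equality of coalgebra maps into [P], hence of
    measuring maps, hence of values on generators, where it is the action law for [a]. *)
Lemma universal_measuring_multiplicative (k : fieldType) (V : lmodType k)
    (H P : bialgType k) (pi : P -> tensor_algebra V -> tensor_algebra V)
    (rho : H -> P) (a : H -> V -> V) :
  universal_measuring_bialgebra pi -> coalgebra_morphism rho ->
  (forall v, a 1 v = v) -> (forall g h v, a (g * h) v = a g (a h v)) ->
  (forall h v, pi (rho h) (tgen v) = tgen (a h v)) -> algebra_morphism rho.
Proof.
move=> hP mr a1 aM ra; have [[mpi _] pi1 piM] := hP.
have [lr rD re] := mr; have [bpi _ _] := mpi.
have m1 (g : P) : comul g = g ⊗ g -> counit g = 1 ->
    coalgebra_morphism (fun c : H => counit c *: g).
  exact: coalgebra_morphism_grouplike.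
have mrr := coalgebra_morphism_comp (@coalgebra_morphism_mul k P)
  (coalgebra_morphism_tmap mr mr).
have mrm := coalgebra_morphism_comp mr (@coalgebra_morphism_mul k H).
split=> // [|g h].
  (* Both [rho 1] and [1] are group-like and fix the generators. The coalgebra maps that they define
     therefore agree, and evaluation at 1 recovers [rho 1 = 1]. *)
  have mr1 : coalgebra_morphism (fun c : H => counit c *: rho 1).
    by apply: m1; rewrite ?rD ?re ?comul1 ?tmap_tens ?counit1.
  have mP1 : coalgebra_morphism (fun c : H => counit c *: (1 : P)).
    by apply: m1; rewrite ?comul1 ?counit1.
  have := universal_measuring_inj hP mr1 mP1 _ 1.
  rewrite counit1 !scale1r; apply.
  apply: measuring_ext; [exact: measuring_comp mpi mr1|exact: measuring_comp mpi mP1|].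
  by move=> c v; rewrite !(linear_scale _ _ (bpi.1 _)) ra a1 pi1.
have := universal_measuring_inj hP mrm mrr _ (g ⊗ h).
rewrite !tens_mulE tmap_tens // tens_mulE; apply.
apply: measuring_ext; [exact: measuring_comp mpi mrm|exact: measuring_comp mpi mrr|].
move=> z v; move: z.
have lm : linear (@tens_mul k H) by exact/tlift_linear/mul_bilin.
have lm' : linear (@tens_mul k P) by exact/tlift_linear/mul_bilin.
apply: tens_ext => [||x y]; [lin|lin|].
by rewrite tmap_tens // !tens_mulE piM !ra aM.
Qed.

(** * Finality of [P_R(V)] among the actions that preserve [R] *)

Theorem proposition4p3 (F : realType) (k : fieldType) (hk : real_or_complex F k)
    (V : lmodType k) (R : V ⊗ V -> V ⊗ V) (hR : braiding R)
    (P : bialgType k) (pi : P -> tensor_algebra V -> tensor_algebra V)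
    (hP : universal_measuring_bialgebra pi)
    (PR : bialgType k) (j : PR -> P) (hPR : R_transformation_algebra R pi j) :
  exists actP : HR_action R (restrict (fun p => pi (j p))),
    @final_object (HR R) (HRObject actP).
Proof.
have [[mpi uni] pi1 piM] := hP; have [[mj inj_j] [st stR] maxj] := hPR.
have [[lj j1 jM] cj] := mj; have [_ jD je] := cj.
have [lR _ _] := hR; have lt := @tgen_linear k V.
have mpij := measuring_comp mpi cj; have [bpij _ _] := mpij.
have bres := restrict_bilin bpij st.
have tr p v : tgen (restrict (fun p => pi (j p)) p v) = pi (j p) (tgen v).
  exact: tgen_restrict (st p v).
have actP : HR_action R (restrict (fun p => pi (j p))).
  split=> // [v|g h v|h].
  - by apply: restrictE; rewrite j1 pi1.
  - by apply: tgen_inj; rewrite !tr (jM g h) piM.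
  (* The hypothesis on [PR] gives commutation with [R] on pure tensors; linearity extends it to all
     of [V ⊗ V]. *)
  - have ld := diag_act_linear h bres.2.
    by apply: tens_ext => [||v w]; [lin|lin|apply: stR].
exists actP => -[H a [ba a1 aM aR]].
have bta : bilin (fun h v => tgen (a h v)) by lin.
have [sigma ms sa] := measuring_extension bta.
have [rho [mr sr rho_uniq]] := uni _ _ ms.
have ra h v : pi (rho h) (tgen v) = tgen (a h v) by rewrite -sr.
have ar := universal_measuring_multiplicative hP mr a1 aM ra.
have [S [i [q [iS mq sq iq]]]] := bialgebra_morphism_image (conj ar mr).
have pS : preserves R (fun s => pi (i s)).
  have piq h v : pi (i (q h)) (tgen v) = tgen (a h v) by rewrite iq.
  have qst s v : exists w, pi (i s) (tgen v) = tgen w.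
    by have [h <-] := sq s; exists (a h v).
  split=> // s v w; have [h <-] := sq s.
  have bS : bilin (restrict (fun s => pi (i s))).
    by apply: restrict_bilin qst; case: (measuring_comp mpi iS.1.2).
  rewrite !(diag_act_morphism _ _ mq bS).
  (* Pulled back along the surjection [q], the action of the image [S] on [V] is the given action of
     [H], which commutes with [R]. *)
  have -> : (fun c => restrict (fun s => pi (i s)) (q c)) = a.
    by apply/funext => c; apply/funext => u; apply: restrictE.
  exact: aR.
have fj h : exists p, rho h = j p.
  by have [p e] := maxj S i iS pS (q h); exists p; rewrite -iq.
(* Preimages are chosen pointwise. Injectivity of [j] makes them unique, so [f] inherits linearity
   and the algebra laws from [rho]; for the coproduct, injectivity of [j ⊗ j] is used. *)
have [f jf] := choice fj.
have [lr r1 rM] := ar; have [_ rD re] := mr.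
have mf : HR_morphism (X := HRObject (And4 ba a1 aM aR)) (Y := HRObject actP) f.
  split; last by move=> h v; apply: restrictE; rewrite -jf.
  have lf : linear f by move=> b x y; apply: inj_j; rewrite -jf lj lr !jf.
  split; split=> //.
  - by apply: inj_j; rewrite -jf r1 j1.
  - by move=> x y; apply: inj_j; rewrite -jf jM rM !jf.
  - move=> h; apply: (tmap_inj lj lj inj_j inj_j).
    by rewrite -jD -jf rD tmap_tmap // (funext jf).
  - by move=> h; rewrite -je -jf re.
exists (exist _ f mf) => -[g [[[lg g1 gM] cg] ga]]; apply: HR_hom_eq => /=.
apply/funext => h; apply: inj_j; rewrite -jf.
have mjg := coalgebra_morphism_comp cj cg.
(* The composite of [j] and [g] is a coalgebra map whose measuring map agrees with [sigma] on [V],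
   hence on [TV], so it is the unique factorization [rho]. *)
suff <- : (fun h => j (g h)) = rho by [].
apply: rho_uniq => // c; apply/funext => t.
apply: (measuring_ext ms (measuring_comp mpi mjg)) => {}c v.
by rewrite sa -tr -(ga c v : restrict _ (g c) v = a c v).
Qed.
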